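(* Let $N$ be a regular ruled surface in $E^3$ with parametrization $\vec r(s,v)=\vec c(s)+v\vec q(s)$, $\|\vec q(s)\|=1$, where $\vec c$ is the striction curve of $N$ and $s$ is the arc length parameter of $\vec c$, with Frenet frame $\{\vec q,\vec h,\vec a\}$ and non-zero invariants $k_1,k_2$. Then $N$ is a $q$-slant ruled surface if and only if $$\vec q\,'''=m\,\vec q\,'+3k_1'\,\vec h',\qquad\text{where } m=\frac{k_1''}{k_1}-(k_1^2+k_2^2),$$ holds for all $s$.
   Context: All maps are smooth and defined on an open interval $I\subset\mathbb R$; $E^3$ is Euclidean 3-space. $N$ is given by $\vec r(s,v)=\vec c(s)+v\vec q(s)$, where $\vec c$ is a unit speed curve and $\vec q$ is a unit vector field along $\vec c$ (the ruling). ''Regular'' refers to the base curve $\vec c$ being a regular curve (here unit speed); points where $\vec r$ fails to be an immersion are not excluded. That $\vec c$ is the striction curve means $\langle \vec c\,',\vec q\,'\rangle=0$. Frenet frame of $N$: $\vec a=\dfrac{\vec q\times\vec q\,'}{\|\vec q\,'\|}$ (central tangent), $\vec h=\vec a\times\vec q$ (central normal). The invariants $k_1,k_2$ are the functions in the Frenet formulae $$\vec q\,'=k_1\vec h,\qquad \vec h'=-k_1\vec q+k_2\vec a,\qquad \vec a'=-k_2\vec h,$$ with $'=d/ds$; both are assumed nowhere zero (so $k_1=\|\vec q\,'\|>0$). $N$ is called $q$-slant if there is a fixed unit vector $\vec u$ and a constant angle $\theta\neq\pi/2$ with $\langle\vec q(s),\vec u\rangle=\cos\theta$ for all $s$. 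*)

(* Defs.v *)
From HB Require Import structures.
From mathcomp Require Import all_boot all_order all_algebra.
From mathcomp Require Import all_classical all_reals all_analysis.

Set Implicit Arguments.
Unset Strict Implicit.
Unset Printing Implicit Defensive.

Import Order.TTheory GRing.Theory Num.Theory.
Import numFieldNormedType.Exports.

Local Open Scope ring_scope.
Local Open Scope classical_set_scope.

Section euclidean_space.
Context {R : realType}.
Implicit Types u v : 'rV[R]_3.

Definition dot u v : R := (u *m v^T) 0 0.

(* The library norm `|u| on 'rV[R]_3 is the sup norm: it induces the right
   topology (hence the right derivatives) but not the Euclidean length. *)
Definition enorm u : R := Num.sqrt (dot u u).

(* Indices are added in 'I_3, that is, modulo 3. *)
Definition cross u v : 'rV[R]_3 :=
  \row_(i < 3) (u 0 (i + 1) * v 0 (i + 2) - u 0 (i + 2) * v 0 (i + 1)).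

End euclidean_space.

(* Maps on an open set I are represented by total functions on R, of which only
   the values on I are constrained; iterated derivatives at points of I depend
   only on these values. *)
Definition smooth_on {R : realType} {V : normedModType R}
    (I : set R) (f : R -> V) : Prop :=
  forall (n : nat) (s : R), I s -> derivable (derive1n n f) s 1.

(* A ruled surface is identified with the data defining its parametrization
   r(s, v) = c(s) + v q(s) (see parametrization below). *)
Record ruled_surface (R : realType) := RuledSurface {
  dom : set R ;
  base : R -> 'rV[R]_3 ;
  ruling : R -> 'rV[R]_3 ;
  dom_open : open dom ;
  dom_interval : is_interval dom ;
  dom_nonempty : dom !=set0 ;
  base_smooth : smooth_on dom base ;
  ruling_smooth : smooth_on dom ruling ;
  ruling_unit : forall s, dom s -> enorm (ruling s) = 1
}.

Section ruled_surface_theory.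
Context {R : realType}.
Implicit Types N : ruled_surface R.

Definition parametrization N (s v : R) : 'rV[R]_3 := base N s + v *: ruling N s.

(* Regularity concerns the base curve only: the parametrization may fail to be
   an immersion at some points. *)
Definition regular N : Prop := forall s, dom N s -> derive1 (base N) s != 0.

Definition arc_length_parametrized N : Prop :=
  forall s, dom N s -> enorm (derive1 (base N) s) = 1.

Definition striction_base N : Prop :=
  forall s, dom N s -> dot (derive1 (base N) s) (derive1 (ruling N) s) = 0.

Definition central_tangent N (s : R) : 'rV[R]_3 :=
  (enorm (derive1 (ruling N) s))^-1 *: cross (ruling N s) (derive1 (ruling N) s).

Definition central_normal N (s : R) : 'rV[R]_3 :=
  cross (central_tangent N s) (ruling N s).

(* k1 and k2 are the coefficients of the Frenet formulae.  The first conjunct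
   says that the Frenet frame is defined (no division by zero in
   central_tangent). *)
Definition frenet_invariants N (k1 k2 : R -> R) : Prop :=
  forall s, dom N s ->
  [/\ derive1 (ruling N) s != 0,
      derive1 (ruling N) s = k1 s *: central_normal N s,
      derive1 (central_normal N) s =
        - k1 s *: ruling N s + k2 s *: central_tangent N s
    & derive1 (central_tangent N) s = - k2 s *: central_normal N s].

(* An angle is a real number in [0, pi]. *)
Definition q_slant N : Prop :=
  exists (u : 'rV[R]_3) (theta : R),
    [/\ enorm u = 1, 0 <= theta <= pi, theta != pi / 2
      & forall s, dom N s -> dot (ruling N s) u = cos theta].

End ruled_surface_theory.

(* Main.v *)
(* The Frenet formulae give
   q''' = m q' + 3 k1' h' + (k1 k2' - k1' k2) a,
   so the differential equation says that k2 / k1 is constant.  If <q, u> is a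
   nonzero constant c, differentiating twice gives k1 c = k2 <a, u> where
   <a, u> is constant, hence k2 / k1 is constant.  Conversely, if k2 / k1 is
   constant, so is w = (k2 / k1) q + a, and <q, w> = k2 / k1. *)
Require Import Defs.
From mathcomp Require Import all_boot all_order all_algebra.
From mathcomp Require Import all_classical all_reals all_analysis.
From mathcomp Require Import ring lra.
Import Order.TTheory GRing.Theory Num.Theory.
Import numFieldNormedType.Exports.
Local Open Scope ring_scope.
Local Open Scope classical_set_scope.

Set Implicit Arguments.
Unset Strict Implicit.

(** * Scalar and cross products in Euclidean 3-space *)

Section euclidean_space.
Context {R : realType}.
Implicit Types u v w : 'rV[R]_3.

Lemma dotE u v : dot u v = \sum_(i < 3) u 0 i * v 0 i.
Proof. by rewrite /dot mxE; apply: eq_bigr => i _; rewrite mxE. Qed.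

Lemma dotC u v : dot u v = dot v u.
Proof. by rewrite !dotE; apply: eq_bigr => i _; rewrite mulrC. Qed.

Lemma dotDl u v w : dot (u + v) w = dot u w + dot v w.
Proof. by rewrite /dot mulmxDl mxE. Qed.

Lemma dotDr u v w : dot w (u + v) = dot w u + dot w v.
Proof. by rewrite dotC dotDl !(dotC w). Qed.

Lemma dotZl (k : R) u v : dot (k *: u) v = k * dot u v.
Proof. by rewrite /dot -scalemxAl mxE. Qed.

Lemma dotZr (k : R) u v : dot u (k *: v) = k * dot u v.
Proof. by rewrite dotC dotZl dotC. Qed.

Lemma dot0l u : dot 0 u = 0.
Proof. by rewrite /dot mul0mx mxE. Qed.

Lemma dotxx_ge0 u : 0 <= dot u u.
Proof. by rewrite dotE sumr_ge0// => i _; rewrite -expr2 sqr_ge0. Qed.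

Lemma dotxx_eq0 u : (dot u u == 0) = (u == 0).
Proof.
apply/eqP/eqP => [|->]; last exact: dot0l.
rewrite dotE => /eqP; rewrite psumr_eq0 => [/allP u0|i _]; last first.
  by rewrite -expr2 sqr_ge0.
apply/rowP => i; rewrite mxE; apply/eqP.
by have := u0 i (mem_index_enum i); rewrite -expr2 sqrf_eq0.
Qed.

Lemma enorm_sqr u : enorm u ^+ 2 = dot u u.
Proof. by rewrite sqr_sqrtr// dotxx_ge0. Qed.

Lemma enorm_eq0 u : (enorm u == 0) = (u == 0).
Proof. by rewrite -sqrf_eq0 enorm_sqr dotxx_eq0. Qed.

Lemma enorm_eq1 u : (enorm u == 1) = (dot u u == 1).
Proof. by rewrite -enorm_sqr sqrp_eq1// sqrtr_ge0. Qed.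

Lemma row3P u v :
  [/\ u 0 0 = v 0 0, u 0 1 = v 0 1 & u 0 2 = v 0 2] -> u = v.
Proof.
move=> [e0 e1 e2]; apply/rowP => i.
(* The indices given by the case analysis and the numerals [0], [1], [2] of ['I_3] have equal values
   but different bound proofs, hence [val_inj]. *)
by case: i => -[|[|[|//]]] Hi; [move: e0|move: e1|move: e2];
  congr (u 0 _ = v 0 _); apply: val_inj.
Qed.

Lemma dot3E u v : dot u v = u 0 0 * v 0 0 + u 0 1 * v 0 1 + u 0 2 * v 0 2.
Proof.
rewrite dotE !big_ord_recl big_ord0 addr0 addrA.
by congr (u 0 _ * v 0 _ + u 0 _ * v 0 _ + u 0 _ * v 0 _); apply: val_inj.
Qed.

Lemma cross3E u v :
  [/\ cross u v 0 0 = u 0 1 * v 0 2 - u 0 2 * v 0 1,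
      cross u v 0 1 = u 0 2 * v 0 0 - u 0 0 * v 0 2
    & cross u v 0 2 = u 0 0 * v 0 1 - u 0 1 * v 0 0].
Proof.
by split; rewrite mxE; congr (u 0 _ * v 0 _ - u 0 _ * v 0 _); apply: val_inj.
Qed.

Lemma crossZl (k : R) u v : cross (k *: u) v = k *: cross u v.
Proof. by apply/rowP => i; rewrite !mxE; ring. Qed.

Lemma crossZr (k : R) u v : cross u (k *: v) = k *: cross u v.
Proof. by apply/rowP => i; rewrite !mxE; ring. Qed.

Lemma double_cross u v w :
  cross (cross u v) w = dot u w *: v - dot v w *: u.
Proof.
apply: row3P; have [e0 e1 e2] := cross3E u v.
have [-> -> ->] := cross3E (cross u v) w; rewrite e0 e1 e2 !dot3E !mxE.
by split; ring.
Qed.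

Lemma dot_crossl u v : dot (cross u v) u = 0.
Proof. by have [e0 e1 e2] := cross3E u v; rewrite dot3E e0 e1 e2; ring. Qed.

Lemma dot_crossr u v : dot (cross u v) v = 0.
Proof. by have [e0 e1 e2] := cross3E u v; rewrite dot3E e0 e1 e2; ring. Qed.

(** Lagrange's identity; it makes the cross product of two orthonormal vectors a unit vector. *)
Lemma dot_crossxx u v :
  dot (cross u v) (cross u v) = dot u u * dot v v - dot u v ^+ 2.
Proof. by have [e0 e1 e2] := cross3E u v; rewrite !dot3E e0 e1 e2; ring. Qed.

End euclidean_space.

(** * Derivatives of curves, and identities that hold only on an open set *)

Section real_curves.
Context {R : realType}.
Implicit Types (D : set R) (s : R).

(** Reduces the product rules below to real-valued functions, where instance inference computes the
    derivative. *)
Lemma is_derive_mx m n (M : R -> 'M[R]_(m, n)) (dM : 'M[R]_(m, n)) s :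
  is_derive s 1 M dM <->
  forall i j, is_derive s 1 (fun t => M t i j) (dM i j).
Proof.
split=> [[dvM <-] i j|dvM].
  split; first exact: (derivable_mxP M s 1).1.
  by rewrite derive_mx// mxE.
have dv : derivable M s 1 by apply/derivable_mxP => i j; case: (dvM i j).
split=> //; rewrite derive_mx//; apply/matrixP => i j.
by rewrite mxE; case: (dvM i j).
Qed.

Lemma is_derive_derive1 (V : normedModType R) (f : R -> V) s :
  derivable f s 1 -> is_derive s 1 f (f^`() s).
Proof. by move=> fs; rewrite derive1E; exact: derivableP. Qed.

Lemma is_derive_scale n (k : R -> R) (f : R -> 'rV[R]_n) s dk df :
  is_derive s 1 k dk -> is_derive s 1 f df ->
  is_derive s 1 (fun t => k t *: f t) (dk *: f s + k s *: df).
Proof.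
move=> ks /is_derive_mx fs; apply/is_derive_mx => i j.
under eq_fun do rewrite mxE.
apply: is_derive_eq.
by rewrite !mxE addrC [f s i j *: _]mulrC.
Qed.

Lemma is_derive_dot (f g : R -> 'rV[R]_3) s df dg :
  is_derive s 1 f df -> is_derive s 1 g dg ->
  is_derive s 1 (fun t => dot (f t) (g t)) (dot df (g s) + dot (f s) dg).
Proof.
move=> /is_derive_mx fs /is_derive_mx gs; under eq_fun do rewrite dot3E.
apply: is_derive_eq.
by rewrite !dot3E /GRing.scale/=; ring.
Qed.

Lemma is_derive_dotl (f : R -> 'rV[R]_3) u s df :
  is_derive s 1 f df -> is_derive s 1 (fun t => dot (f t) u) (dot df u).
Proof.
move=> fs.
have us : is_derive s 1 (fun=> u) (0 : 'rV[R]_3) by exact: is_derive_cst.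
apply: (is_derive_eq (is_derive_dot fs us)).
by rewrite dotC [X in _ + X]dotC !dot0l addr0 dotC.
Qed.

Lemma is_derive_cross (f g : R -> 'rV[R]_3) s df dg :
  is_derive s 1 f df -> is_derive s 1 g dg ->
  is_derive s 1 (fun t => cross (f t) (g t)) (cross df (g s) + cross (f s) dg).
Proof.
move=> /is_derive_mx fs /is_derive_mx gs; apply/is_derive_mx => i j.
under eq_fun do rewrite mxE.
apply: is_derive_eq.
by rewrite !mxE /GRing.scale/=; ring.
Qed.

(** The square root is differentiable only at positive arguments, whence the condition
    [f s != 0]. *)
Lemma derivable_enorm (f : R -> 'rV[R]_3) s :
  f s != 0 -> derivable f s 1 -> derivable (fun t => enorm (f t)) s 1.
Proof.
move=> fs0 /is_derive_derive1 fs.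
have fs_gt0 : 0 < dot (f s) (f s) by rewrite lt0r dotxx_eq0 fs0 dotxx_ge0.
have sq := is_derive1_sqrt fs_gt0.
by case: (is_derive1_comp sq (is_derive_dot fs fs)).
Qed.

(** A derivative depends only on the values near [s], and the open set [D] is a neighbourhood of
    [s]. This transfers differentiability from explicit formulas to functions that are known on the
    domain only. *)
Lemma eq_on_is_derive D (V : normedModType R) (f g : R -> V) s df :
  open D -> D s -> (forall t, D t -> f t = g t) ->
  is_derive s 1 f df -> is_derive s 1 g df.
Proof.
move=> oD Ds fg; apply: near_eq_is_derive.
by near do apply: fg; exact: open_nbhs_nbhs.
Unshelve. all: by end_near. Qed.

Lemma eq_on_derive1 D (V : normedModType R) (f g : R -> V) s df dg :
  open D -> D s -> (forall t, D t -> f t = g t) ->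
  is_derive s 1 f df -> is_derive s 1 g dg -> df = dg.
Proof.
move=> oD Ds fg fs [_ <-].
by have [_ <-] := eq_on_is_derive oD Ds fg fs.
Qed.

(** Mean value theorem on the segment between the two points, which lies in [D] because [D] is an
    interval. *)
Lemma is_derive_0_cst_on D (f : R -> R) : is_interval D ->
  (forall s, D s -> is_derive s 1 f 0) ->
  forall s t, D s -> D t -> f s = f t.
Proof.
move=> iD f0; suff H s t : D s -> D t -> s <= t -> f s = f t.
  by move=> s t Ds Dt; have [/H->|/ltW/H->] := leP s t.
move=> Ds Dt st.
have Dst x : x \in `[s, t]%R -> D x by rewrite in_itv; exact: iD.
have [x xst| |x _] := @MVT_segment _ f (fun=> 0) s t st.
- by apply/f0/Dst; exact: subset_itv_oo_cc xst.
- apply: derivable_within_continuous => x /Dst Dx.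
  by case: (f0 x Dx).
- by rewrite mul0r => /eqP; rewrite subr_eq0 => /eqP.
Qed.

End real_curves.

(** * Orthonormality of the Frenet frame *)

Section frenet_frame.
Context {R : realType} (N : ruled_surface R) (k1 k2 : R -> R)
  (N_frenet : frenet_invariants N k1 k2)
  (k1_neq0 : forall s, dom N s -> k1 s != 0).

Local Notation q := (ruling N).
Local Notation h := (central_normal N).
Local Notation a := (central_tangent N).
Local Notation D := (dom N).

Let oD : open D := @dom_open _ N.

Lemma ruling_dot1 s : D s -> dot (q s) (q s) = 1.
Proof. by move=> /ruling_unit/eqP; rewrite enorm_eq1 => /eqP. Qed.

Lemma is_derive_ruling n s : D s ->
  is_derive s 1 (derive1n n q) (derive1n n.+1 q s).
Proof.
by move=> Ds; rewrite derive1nS; apply/is_derive_derive1/ruling_smooth.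
Qed.

(** Differentiating [dot (q s) (q s) = 1] gives twice this product. *)
Lemma dot_ruling_derive1 s : D s -> dot (q s) (derive1 q s) = 0.
Proof.
move=> Ds; have dq := is_derive_ruling 0 Ds.
have := eq_on_derive1 oD Ds ruling_dot1
  (is_derive_dot dq dq) (is_derive_cst _ _ _).
by rewrite derive1n1 derive1n0 (dotC (derive1 q s)) => /eqP;
  rewrite -mulr2n mulrn_eq0 => /eqP.
Qed.

(** The double cross product expands to [dot q q *: q' - dot q' q *: q], where the first coefficient
    is 1 and the second 0. *)
Lemma central_normalE s : D s -> h s = (enorm (derive1 q s))^-1 *: derive1 q s.
Proof.
move=> Ds; rewrite /central_normal /central_tangent crossZl double_cross.
rewrite ruling_dot1// scale1r (dotC (derive1 q s)).
by rewrite dot_ruling_derive1// scale0r subr0.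
Qed.

Lemma central_tangentE s : D s -> a s = cross (q s) (h s).
Proof. by move=> Ds; rewrite central_normalE// crossZr. Qed.

Lemma central_normal_dot1 s : D s -> dot (h s) (h s) = 1.
Proof.
move=> Ds; have [q'0 _ _ _] := N_frenet Ds.
rewrite central_normalE// dotZl dotZr -enorm_sqr expr2.
by rewrite mulKf ?mulVf// enorm_eq0.
Qed.

Lemma dot_ruling_normal s : D s -> dot (q s) (h s) = 0.
Proof.
by move=> Ds; rewrite central_normalE// dotZr dot_ruling_derive1// mulr0.
Qed.

Lemma central_tangent_dot1 s : D s -> dot (a s) (a s) = 1.
Proof.
move=> Ds; rewrite central_tangentE// dot_crossxx ruling_dot1//.
by rewrite central_normal_dot1// dot_ruling_normal// expr0n/= mul1r subr0.
Qed.

Lemma dot_ruling_tangent s : D s -> dot (q s) (a s) = 0.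
Proof. by move=> Ds; rewrite central_tangentE// dotC dot_crossl. Qed.

Lemma dot_normal_tangent s : D s -> dot (h s) (a s) = 0.
Proof. by move=> Ds; rewrite central_tangentE// dotC dot_crossr. Qed.

(** * Differentiability of the frame and of the invariants *)

Lemma is_derive_q s : D s -> is_derive s 1 q (k1 s *: h s).
Proof.
move=> Ds; have [_ q'E _ _] := N_frenet Ds.
by rewrite -q'E; exact: (is_derive_ruling 0).
Qed.

(** The Frenet formulae only give the value of [derive1], which is also defined where the function
    is not differentiable. Differentiability itself comes from [central_normalE], a quotient of
    smooth data with nonzero denominator. *)
Lemma is_derive_normal s : D s ->
  is_derive s 1 h (- k1 s *: q s + k2 s *: a s).
Proof.
move=> Ds; have [q'0 _ <- _] := N_frenet Ds; apply: is_derive_derive1.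
have dq' : is_derive s 1 (derive1 q) (derive1n 2 q s) := is_derive_ruling 1 Ds.
have de : derivable (fun t => enorm (derive1 q t)) s 1.
  by apply: derivable_enorm => //; case: dq'.
have e0 : enorm (derive1 q s) != 0 by rewrite enorm_eq0.
have dh := is_derive_scale
  (is_deriveV (f := fun t => enorm (derive1 q t)) e0 (is_derive_derive1 de))
  dq'.
by case: (eq_on_is_derive oD Ds
  (fun t Dt => esym (central_normalE Dt)) dh).
Qed.

(** Differentiability comes from writing [a] as the cross product of [q] and [h]. *)
Lemma is_derive_tangent s : D s -> is_derive s 1 a (- k2 s *: h s).
Proof.
move=> Ds; have [_ _ _ <-] := N_frenet Ds; apply: is_derive_derive1.
have da := is_derive_cross (is_derive_q Ds) (is_derive_normal Ds).
by case: (eq_on_is_derive oD Ds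
  (fun t Dt => esym (central_tangentE Dt)) da).
Qed.

(** No smoothness of the invariants is assumed: they inherit it from the frame, here through
    [k1 = dot q' h] on the domain. *)
Lemma is_derive_k1 s : D s -> is_derive s 1 k1 (derive1 k1 s).
Proof.
move=> Ds; apply: is_derive_derive1.
have k1E t : D t -> dot (derive1 q t) (h t) = k1 t.
  move=> Dt; have [_ -> _ _] := N_frenet Dt.
  by rewrite dotZl central_normal_dot1// mulr1.
by case: (eq_on_is_derive oD Ds k1E
  (is_derive_dot (is_derive_ruling 1 Ds) (is_derive_normal Ds))).
Qed.

Lemma ruling_derive2E s : D s ->
  derive1n 2 q s = derive1 k1 s *: h s + k1 s *: (- k1 s *: q s + k2 s *: a s).
Proof.
move=> Ds.
apply: (eq_on_derive1 (f := derive1 q) (g := fun t => k1 t *: h t) oD Ds).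
- by move=> t Dt; have [_ -> _ _] := N_frenet Dt.
- exact: (is_derive_ruling 1).
- exact: is_derive_scale (is_derive_k1 Ds) (is_derive_normal Ds).
Qed.

Lemma is_derive_derive1_k1 s : D s ->
  is_derive s 1 (derive1 k1) (derive1n 2 k1 s).
Proof.
move=> Ds; apply: is_derive_derive1.
(* The derivative of [k1] is the [h]-component of [q''], a product of differentiable curves. *)
have k1'E t : D t -> dot (derive1n 2 q t) (h t) = derive1 k1 t.
  move=> Dt; rewrite ruling_derive2E// dotDl (dotZl (derive1 k1 t)).
  rewrite (dotZl (k1 t)) dotDl (dotZl (- k1 t)) (dotZl (k2 t)) (dotC (a t)).
  rewrite central_normal_dot1// dot_ruling_normal// dot_normal_tangent//.
  by ring.
by case: (eq_on_is_derive oD Ds k1'E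
  (is_derive_dot (is_derive_ruling 2 Ds) (is_derive_normal Ds))).
Qed.

Lemma is_derive_k2 s : D s -> is_derive s 1 k2 (derive1 k2 s).
Proof.
move=> Ds; apply: is_derive_derive1.
(* The [a]-component of [q''] is [k1 * k2], so [k2] is recovered by dividing by [k1]. *)
have k2E t : D t -> (k1 t)^-1 * dot (derive1n 2 q t) (a t) = k2 t.
  move=> Dt; rewrite ruling_derive2E// dotDl (dotZl (derive1 k1 t)).
  rewrite (dotZl (k1 t)) dotDl (dotZl (- k1 t)) (dotZl (k2 t)).
  rewrite central_tangent_dot1// dot_ruling_tangent// dot_normal_tangent//.
  by field; exact: k1_neq0.
have d1 := is_deriveV (f := k1) (k1_neq0 Ds) (is_derive_k1 Ds).
have d2 := is_derive_dot (is_derive_ruling 2 Ds)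
  (is_derive_tangent Ds).
by case: (eq_on_is_derive oD Ds k2E (is_deriveM d1 d2)).
Qed.

(** * The third derivative of the ruling and the differential equation *)

Lemma ruling_derive3E s : D s ->
  derive1n 3 q s =
    (derive1n 2 k1 s / k1 s - (k1 s ^+ 2 + k2 s ^+ 2)) *: derive1 q s
    + (3 * derive1 k1 s) *: derive1 h s
    + (k1 s * derive1 k2 s - derive1 k1 s * k2 s) *: a s.
Proof.
move=> Ds; have [_ -> -> _] := N_frenet Ds.
have dk1 := is_derive_k1 Ds; have dk2 := is_derive_k2 Ds.
have dh := is_derive_normal Ds; have da := is_derive_tangent Ds.
have dNk1 : is_derive s 1 (fun t => - k1 t) (- derive1 k1 s).
  exact: is_deriveN.
have dh' : is_derive s 1 (fun t => - k1 t *: q t + k2 t *: a t) _ :=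
  is_deriveD (is_derive_scale dNk1 (is_derive_q Ds))
    (is_derive_scale dk2 da).
have dq'' := is_deriveD
  (is_derive_scale (is_derive_derive1_k1 Ds) dh)
  (is_derive_scale dk1 dh').
rewrite (eq_on_derive1 oD Ds ruling_derive2E
  (is_derive_ruling 2 Ds) dq'').
(* Both sides are linear combinations of the frame vectors with equal coefficients, so the identity
   holds for arbitrary vectors and is checked coordinate by coordinate. *)
move: (q s) (h s) (a s) => qs hs as_; apply/rowP => i.
by rewrite !mxE; field; exact: k1_neq0.
Qed.

(** The two sides of the equation differ by a multiple of the unit vector [a]; the scalar product
    with [a] extracts the coefficient. *)
Lemma ruling_ode_iff s : D s ->
  derive1n 3 q s =
    (derive1n 2 k1 s / k1 s - (k1 s ^+ 2 + k2 s ^+ 2)) *: derive1 q s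
    + (3 * derive1 k1 s) *: derive1 h s
  <-> k1 s * derive1 k2 s = derive1 k1 s * k2 s.
Proof.
move=> Ds; rewrite ruling_derive3E//; split=> [/eqP|->]; last first.
  by rewrite subrr scale0r addr0.
rewrite addrC -subr_eq0 addrK => /eqP/(congr1 (fun u => dot u (a s))).
rewrite dotZl central_tangent_dot1// dot0l mulr1 => /eqP.
by rewrite subr_eq0 => /eqP.
Qed.

(** * Slant rulings and constancy of the ratio of the invariants *)

Lemma q_slant_ratio : q_slant N ->
  forall s, D s -> k1 s * derive1 k2 s = derive1 k1 s * k2 s.
Proof.
move=> [u [theta [_ /andP[theta_ge0 theta_lepi] theta_neq qu]]].
(* The cosine is injective on [[0, pi]], so [pi / 2] is its only zero there. *)
have c_neq0 : cos theta != 0.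
  apply: contra theta_neq => /eqP c0; apply/eqP.
  apply: cos_inj; rewrite ?cos_pihalf// in_itv/= ?theta_ge0//.
  by have := @pi_ge0 R; lra.
have hu s : D s -> dot (h s) u = 0.
  move=> Ds; have := eq_on_derive1 oD Ds qu
    (is_derive_dotl u (is_derive_q Ds)) (is_derive_cst _ _ _).
  rewrite (dotZl (k1 s)) => /eqP.
  by rewrite mulf_eq0 (negPf (k1_neq0 Ds)) => /eqP.
have au s : D s -> k1 s * cos theta = k2 s * dot (a s) u.
  move=> Ds; have := eq_on_derive1 oD Ds hu
    (is_derive_dotl u (is_derive_normal Ds)) (is_derive_cst _ _ _).
  by rewrite dotDl (dotZl (- k1 s)) (dotZl (k2 s)) qu// => ?; lra.
move=> s Ds; have dk1 := is_derive_k1 Ds; have dk2 := is_derive_k2 Ds.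
have dau := is_derive_dotl u (is_derive_tangent Ds).
have dk1c : is_derive s 1 (fun t => k1 t * cos theta)
    (derive1 k1 s * cos theta).
  by apply: is_derive_eq; rewrite /GRing.scale/=; ring.
have := eq_on_derive1 oD Ds au dk1c (is_deriveM dk2 dau).
rewrite (dotZl (- k2 s)) hu// /GRing.scale/= !mulr0 add0r => dk.
(* After multiplication by [cos theta], both sides equal [k2 * k2' * dot a u]: the left one by [au],
   the right one by its derivative [dk]. *)
by apply: (mulIf c_neq0); rewrite mulrAC au// [RHS]mulrAC dk; ring.
Qed.

Lemma ratio_q_slant : (forall s, D s -> k2 s != 0) ->
  (forall s, D s -> k1 s * derive1 k2 s = derive1 k1 s * k2 s) -> q_slant N.
Proof.
move=> k2_neq0 ratio; have [s0 Ds0] := @dom_nonempty _ N.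
(* [w] is the Darboux vector [k2 q + k1 a] (angular velocity of the frame) divided by [k1]. Once
   shown constant, its value at [s0] serves as the fixed direction. *)
pose t s := (k1 s)^-1 * k2 s; pose w s := t s *: q s + a s.
have t'0 s : D s -> is_derive s 1 t 0.
  move=> Ds; have k10 := k1_neq0 Ds.
  have d1 := is_deriveV (f := k1) k10 (is_derive_k1 Ds).
  apply: (is_derive_eq (is_deriveM d1 (is_derive_k2 Ds))).
  (* Multiplying [t'] by [k1 ^+ 2] clears the denominators and leaves the numerator of the quotient
     rule. *)
  apply: (mulfI (expf_neq0 2 k10)); rewrite mulr0 /GRing.scale/=.
  transitivity (k1 s * derive1 k2 s - derive1 k1 s * k2 s); first by field.
  by rewrite ratio// subrr.
have w'0 s : D s -> is_derive s 1 w 0.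
  move=> Ds; have k10 := k1_neq0 Ds.
  apply: (is_derive_eq (is_deriveD (is_derive_scale (t'0 _ Ds)
    (is_derive_q Ds)) (is_derive_tangent Ds))).
  (* The [h]-terms cancel because [t * k1 = k2]. *)
  by move: (q s) (h s) => qs hs; apply/rowP => i; rewrite !mxE /t; field.
have tE s : D s -> t s = t s0.
  by move=> Ds; exact: (is_derive_0_cst_on (@dom_interval _ N) t'0).
have wE s : D s -> w s = w s0.
  move=> Ds; apply/rowP => i.
  apply: (@is_derive_0_cst_on _ _ (fun r => w r 0 i) (@dom_interval _ N)) => //.
  by move=> r /w'0/is_derive_mx/(_ 0 i); rewrite mxE.
have qw s : D s -> dot (q s) (w s0) = t s0.
  move=> Ds; rewrite -(wE _ Ds) dotDr (dotZr (t s)).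
  by rewrite ruling_dot1// dot_ruling_tangent// mulr1 addr0 tE.
have ww : dot (w s0) (w s0) = 1 + t s0 ^+ 2.
  rewrite {1}/w dotDl (dotZl (t s0)) qw// dotDr (dotZr (t s0)) dotC.
  by rewrite dot_ruling_tangent// central_tangent_dot1//; ring.
have e_neq0 : enorm (w s0) != 0.
  by rewrite -sqrf_eq0 enorm_sqr ww; have := sqr_ge0 (t s0); lra.
(* The cosine of the angle between the ruling and [w s0]; it lies in [[-1, 1]] because the squared
   length of [w s0] is [1 + t s0 ^+ 2]. *)
pose x := (enorm (w s0))^-1 * t s0.
have x_itv : -1 <= x <= 1.
  rewrite -ler_norml -(@ler_pXn2r _ 2) ?nnegrE// real_normK ?num_real//.
  rewrite expr1n exprMn exprVn enorm_sqr ww mulrC ler_pdivrMr.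
    by rewrite mul1r; lra.
  by have := sqr_ge0 (t s0); lra.
have xK : cos (acos x) = x by rewrite acosK// in_itv.
(* Here [k2 != 0] enters: it keeps the angle [acos x] away from [pi / 2]. *)
have x_neq0 : x != 0.
  by rewrite mulf_neq0 ?invr_eq0// mulf_neq0 ?invr_eq0 ?k1_neq0 ?k2_neq0.
exists ((enorm (w s0))^-1 *: w s0), (acos x); split.
- apply/eqP; rewrite enorm_eq1 dotZl dotZr -enorm_sqr.
  by apply/eqP; field.
- by rewrite acos_ge0// acos_lepi.
- apply: contra x_neq0 => /eqP ax.
  by rewrite -xK ax cos_pihalf.
- by move=> s Ds; rewrite dotZr qw// xK.
Qed.

End frenet_frame.

Unset Implicit Arguments.
Set Strict Implicit.

Theorem theorem3p4 (R : realType) (N : ruled_surface R) (k1 k2 : R -> R)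
    (N_regular : regular N)
    (N_arc_length : arc_length_parametrized N)
    (N_striction : striction_base N)
    (N_frenet : frenet_invariants N k1 k2)
    (k1_neq0 : forall s, dom N s -> k1 s != 0)
    (k2_neq0 : forall s, dom N s -> k2 s != 0) :
  let q := ruling N in
  let h := central_normal N in
  let m := fun s : R =>
    derive1n 2 k1 s / k1 s - (k1 s ^+ 2 + k2 s ^+ 2) in
  q_slant N <->
  (forall s, dom N s ->
    derive1n 3 q s = m s *: derive1 q s + (3 * derive1 k1 s) *: derive1 h s).
Proof.
move=> q h m; split=> [slant s Ds|ode].
  apply: (ruling_ode_iff N_frenet k1_neq0 Ds).2.
  exact: (q_slant_ratio N_frenet k1_neq0 slant).
apply: (ratio_q_slant N_frenet k1_neq0 k2_neq0) => s Ds.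
exact: (ruling_ode_iff N_frenet k1_neq0 Ds).1 (ode s Ds).
Qed.
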